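(* For all $n\ge1$, $$a_{\{0101,0102,0112\}}(n)=a_{\{0101,0102,0120\}}(n)=a_{\{0101,0102,0121\}}(n)=a_{\{0101,0112,0121\}}(n)=a_{\{0101,0120,0121\}}(n)=a_{\{0102,0120,0121\}}(n)=2^n-n.$$
   Context: An ascent in an integer sequence $s_1\cdots s_m$ is an index $j$ with $s_j<s_{j+1}$; $\mathrm{asc}$ denotes the number of ascents. An ascent sequence is a sequence $x_1\cdots x_n$ of nonnegative integers with $x_1=0$ and $x_i\le 1+\mathrm{asc}(x_1\cdots x_{i-1})$ for all $i\ge2$. The reduction $\mathrm{red}(w)$ of an integer sequence $w$ replaces the $i$-th smallest distinct letter of $w$ by $i-1$; a pattern is a reduced sequence. A sequence $x$ contains a pattern $p=p_1\cdots p_k$ if there are indices $i_1<\cdots<i_k$ with $\mathrm{red}(x_{i_1}\cdots x_{i_k})=p$; otherwise $x$ avoids $p$. For a finite set $P$ of patterns, $a_P(n)$ denotes the number of ascent sequences of length $n$ avoiding every pattern in $P$. *)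

(* Defs.v *)
From mathcomp Require Import all_boot.
Set Implicit Arguments. Unset Strict Implicit. Unset Printing Implicit Defensive.

Fixpoint asc (s : seq nat) : nat :=
  match s with
  | x :: ((y :: _) as t) => (x < y) + asc t
  | _ => 0
  end.

Definition is_ascent_seq (x : seq nat) : bool :=
  (head 0 x == 0) &&
  [forall i : 'I_(size x), (0 < val i) ==> (nth 0 x i <= (asc (take i x)).+1)].

(* reduction: the i-th smallest distinct letter (i >= 1) becomes i-1, i.e. each
   letter a is replaced by the number of distinct letters of w smaller than a *)
Definition red (w : seq nat) : seq nat :=
  [seq size (undup [seq b <- w | b < a]) | a <- w].

(* x contains p : some subsequence (indices i_1 < ... < i_k) reduces to p
   (a subsequence given by a selection mask m; red preserves length) *)
Definition contains (x p : seq nat) : bool :=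
  [exists m : (size x).-tuple bool, red (mask m x) == p].

Definition avoids (x p : seq nat) : bool := ~~ contains x p.

(* a_P(n): number of ascent sequences of length n avoiding every pattern of P.
   Every ascent sequence of length n has entries x_i <= i-1 < n, so all of them
   are enumerated by n-tuples over 'I_n. *)
Definition a_P (P : seq (seq nat)) (n : nat) : nat :=
  #|[set t : n.-tuple 'I_n |
      is_ascent_seq (map val t) &
      all (avoids (map val t)) P]|.

(* Main.v *)
(** Every sequence counted here is a restricted growth function, so it is either
    constant 0 or of the form [0^i 1 w].  The sequences are grown letter by letter
    in a generating tree whose labels record the maximum [k] and what is known
    about the occurrences of 010 and 011; in a restricted growth function the
    occurrences of 01 and 012 are determined by [k].  For each of the six sets a
    node [0^i 1] turns out to have [2^(m+1) - 1] descendants [m] levels below.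
    Since all patterns start with 01, a node [0^i] always has the two children
    [0^(i+1)] and [0^i 1], and summation gives [2^n - n]. *)

Require Import Defs.
From mathcomp Require Import all_boot.
From mathcomp Require Import zify.
Set Implicit Arguments. Unset Strict Implicit. Unset Printing Implicit Defensive.

(** * Subsequences, reduction and pattern containment when a letter is appended *)

Lemma subseq_rcons_rcons (T : eqType) (u s : seq T) (x k : T) :
  subseq (rcons u x) (rcons s k) =
  subseq (rcons u x) s || ((x == k) && subseq u s).
Proof.
(* Reversal turns last letters into first letters, where [subseq] computes; the lines below restore
   the disjunct absorbed when the letters match. *)
rewrite -subseq_rev !rev_rcons /= -[subseq (rcons u x) s]subseq_rev rev_rcons.
case: eqP => [->|_] /=; last by rewrite orbF.
rewrite subseq_rev; case: (boolP (subseq u s)) => [|nus]; first by rewrite orbT.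
rewrite orbF; apply/esym/negbTE; apply: contra nus => h.
by rewrite -subseq_rev (subseq_trans (subseq_cons _ _) h).
Qed.

Lemma size_red w : size (red w) = size w.
Proof. exact: size_map. Qed.

(** Reduction preserves order: if a < b, the letters below a are also below b, and a itself is below
    b but not below a, so the count strictly grows. *)
Lemma red_ltn w i j : i < size w -> j < size w ->
  (nth 0 w i < nth 0 w j) = (nth 0 (red w) i < nth 0 (red w) j).
Proof.
move=> iw jw; rewrite !(nth_map 0) //.
set a := nth 0 w i; set b := nth 0 w j.
have ha : a \in w by exact: mem_nth.
case: ltnP => [ab|ba]; apply/esym.
  rewrite -[X in X < _]/(size (undup _)) ltnNge; apply/negP => le.
  have sub : {subset undup [seq c <- w | c < a] <= undup [seq c <- w | c < b]}.
    move=> c; rewrite !mem_undup !mem_filter => /andP[ca ->].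
    by rewrite (ltn_trans ca ab).
  have [_ eqs] := uniq_min_size (undup_uniq _) sub le.
  by have := eqs a; rewrite !mem_undup !mem_filter ltnn ab ha.
apply/negbTE; rewrite -leqNgt; apply: uniq_leq_size; first exact: undup_uniq.
move=> c; rewrite !mem_undup !mem_filter => /andP[cb ->].
by rewrite (leq_trans cb ba).
Qed.

Lemma containsP x p :
  reflect (exists2 u, subseq u x & red u = p) (contains x p).
Proof.
apply: (iffP existsP) => [[m /eqP e]|[u /subseqP[m sm ->] e]].
  by exists (mask m x) => //; apply: mask_subseq.
by exists (Tuple (introT eqP sm)); rewrite /= e.
Qed.

(** An occurrence in [rcons s k] that is not already in [s] must end in the new letter. *)
Lemma avoids_rcons p s k : p != [::] ->
  reflect (avoids s p /\ forall u, subseq u s -> red (rcons u k) <> p)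
          (avoids (rcons s k) p).
Proof.
move=> p0; apply: (iffP idP) => [h|[h1 h2]].
  split=> [|u us e].
    apply: contra h => /containsP[u us e]; apply/containsP; exists u => //.
    exact: subseq_trans us (subseq_rcons _ _).
  move/negP: h; apply; apply/containsP; exists (rcons u k) => //.
  by rewrite subseq_rcons_rcons eqxx us orbT.
apply/negP => /containsP[u us e].
case/lastP: u => [|u x] in us e; first by rewrite -e in p0.
move: us; rewrite subseq_rcons_rcons => /orP[us|/andP[/eqP xk us]].
  by move/negP: h1; apply; apply/containsP; exists (rcons u x).
by subst x; apply: (h2 u).
Qed.

(** * Occurrences of 01, 010, 011 and 012 with prescribed letters *)

Definition oc01 s a b := (a < b) && subseq [:: a; b] s.
Definition oc010 s a b := (a < b) && subseq [:: a; b; a] s.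
Definition oc011 s a b := (a < b) && subseq [:: a; b; b] s.
Definition oc012 s a b c := [&& a < b, b < c & subseq [:: a; b; c] s].

Lemma oc01_rcons s k a b :
  oc01 (rcons s k) a b = oc01 s a b || [&& b == k, a < b & a \in s].
Proof.
rewrite /oc01 -[[:: a; b]]/(rcons [:: a] b) subseq_rcons_rcons sub1seq /=.
by case: (a < b); rewrite ?andbF.
Qed.

Lemma oc010_rcons s k a b :
  oc010 (rcons s k) a b = oc010 s a b || ((a == k) && oc01 s a b).
Proof.
rewrite /oc010 /oc01 -[[:: a; b; a]]/(rcons [:: a; b] a) subseq_rcons_rcons /=.
by case: (a < b); rewrite ?andbF.
Qed.

Lemma oc011_rcons s k a b :
  oc011 (rcons s k) a b = oc011 s a b || ((b == k) && oc01 s a b).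
Proof.
rewrite /oc011 /oc01 -[[:: a; b; b]]/(rcons [:: a; b] b) subseq_rcons_rcons /=.
by case: (a < b); rewrite ?andbF.
Qed.

Lemma oc012_rcons s k a b c :
  oc012 (rcons s k) a b c =
  oc012 s a b c || [&& c == k, b < c & oc01 s a b].
Proof.
rewrite /oc012 /oc01 -[[:: a; b; c]]/(rcons [:: a; b] c) subseq_rcons_rcons /=.
by case: (a < b); case: (b < c); rewrite ?andbF.
Qed.

Definition keeps_avoiding p s k := forall u, subseq u s -> red (rcons u k) <> p.

(** All comparisons are listed in both directions, so that [lia] can also derive equality of two
    letters: neither is smaller than the other. *)
Lemma red4_ltn a b c d p0 p1 p2 p3 :
  red [:: a; b; c; d] = [:: p0; p1; p2; p3] ->
  [/\ [/\ (a < b) = (p0 < p1), (b < a) = (p1 < p0),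
          (a < c) = (p0 < p2) & (c < a) = (p2 < p0)],
      [/\ (a < d) = (p0 < p3), (d < a) = (p3 < p0),
          (b < c) = (p1 < p2) & (c < b) = (p2 < p1)] &
      [/\ (b < d) = (p1 < p3), (d < b) = (p3 < p1),
          (c < d) = (p2 < p3) & (d < c) = (p3 < p2)]].
Proof.
move=> e; have H := @red_ltn [:: a; b; c; d]; rewrite e in H.
split; split.
- exact: (H 0 1).
- exact: (H 1 0).
- exact: (H 0 2).
- exact: (H 2 0).
- exact: (H 0 3).
- exact: (H 3 0).
- exact: (H 1 2).
- exact: (H 2 1).
- exact: (H 1 3).
- exact: (H 3 1).
- exact: (H 2 3).
- exact: (H 3 2).
Qed.

Lemma red_rcons4P u k p0 p1 p2 p3 : red (rcons u k) = [:: p0; p1; p2; p3] ->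
  exists a b c, u = [:: a; b; c].
Proof.
move=> e; have := size_red (rcons u k); rewrite e size_rcons.
by case: u {e} => [|a [|b [|c []]]] //; exists a, b, c.
Qed.

Lemma ltn_neq a b : a < b -> ((a == b) = false) * ((b == a) = false) * ((b < a) = false).
Proof. by move=> h; split; [split|]; lia. Qed.

(** Evaluates [red] on a word whose strict comparisons are in the context. Consequences by
    transitivity must be put there beforehand. *)
Ltac red4 := rewrite /red /= ?ltnn /=;
  repeat match goal with h : is_true (?x < ?y) |- _ =>
    rewrite ?h ?(ltn_neq h) /= ?inE ?eqxx ?h ?(ltn_neq h) /=; clear h end.

(** A new occurrence ends in [k], so its first three letters form a 010 with middle letter [k]. The
    next four lemmas work alike: 0102 and 0112 forbid letters above the larger letter of a 010 or
    011, while 0120 and 0121 forbid the first or the middle letter of a 012. *)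
Lemma keeps_avoiding_0101 s k : keeps_avoiding [:: 0; 1; 0; 1] s k <-> forall a, ~~ oc010 s a k.
Proof.
split=> [h a|h u us e].
  apply/negP => /andP[ak sb]; by apply: (h _ sb); red4.
have [a [b [c eu]]] := red_rcons4P e; subst u.
have [[h1 h2 h3 h4] [h5 h6 h7 h8] [h9 h10 h11 h12]] := red4_ltn e.
have ? : c = a by lia.
have ? : b = k by lia.
by subst; have := h a; rewrite /oc010 h1 us.
Qed.

Lemma keeps_avoiding_0102 s k :
  keeps_avoiding [:: 0; 1; 0; 2] s k <-> forall a b, oc010 s a b -> k <= b.
Proof.
split=> [h a b /andP[ab sb]|h u us e].
  rewrite leqNgt; apply/negP => bk; have ak := ltn_trans ab bk.
  by apply: (h _ sb); red4.
have [a [b [c eu]]] := red_rcons4P e; subst u.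
have [[h1 h2 h3 h4] [h5 h6 h7 h8] [h9 h10 h11 h12]] := red4_ltn e.
have ? : c = a by lia.
by subst; have := h a b; rewrite /oc010 h1 us; lia.
Qed.

Lemma keeps_avoiding_0112 s k :
  keeps_avoiding [:: 0; 1; 1; 2] s k <-> forall a b, oc011 s a b -> k <= b.
Proof.
split=> [h a b /andP[ab sb]|h u us e].
  rewrite leqNgt; apply/negP => bk; have ak := ltn_trans ab bk.
  by apply: (h _ sb); red4.
have [a [b [c eu]]] := red_rcons4P e; subst u.
have [[h1 h2 h3 h4] [h5 h6 h7 h8] [h9 h10 h11 h12]] := red4_ltn e.
have ? : c = b by lia.
by subst; have := h a b; rewrite /oc011 h1 us; lia.
Qed.

Lemma keeps_avoiding_0120 s k :
  keeps_avoiding [:: 0; 1; 2; 0] s k <-> forall b c, ~~ oc012 s k b c.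
Proof.
split=> [h b c|h u us e].
  apply/negP => /and3P[kb bc sb]; have kc := ltn_trans kb bc.
  by apply: (h _ sb); red4.
have [a [b [c eu]]] := red_rcons4P e; subst u.
have [[h1 h2 h3 h4] [h5 h6 h7 h8] [h9 h10 h11 h12]] := red4_ltn e.
have ? : a = k by lia.
by subst; have := h b c; rewrite /oc012 h1 h7 us.
Qed.

Lemma keeps_avoiding_0121 s k :
  keeps_avoiding [:: 0; 1; 2; 1] s k <-> forall a c, ~~ oc012 s a k c.
Proof.
split=> [h a c|h u us e].
  apply/negP => /and3P[ak kc sb]; have ac := ltn_trans ak kc.
  by apply: (h _ sb); red4.
have [a [b [c eu]]] := red_rcons4P e; subst u.
have [[h1 h2 h3 h4] [h5 h6 h7 h8] [h9 h10 h11 h12]] := red4_ltn e.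
have ? : b = k by lia.
by subst; have := h a c; rewrite /oc012 h1 h7 us.
Qed.

(** * Ascent sequences and validity when a letter is appended *)

Lemma asc_rcons s k : s != [::] -> asc (rcons s k) = asc s + (last 0 s < k).
Proof.
case: s => // x s _; elim: s x => [|y s IH] x /=; first by rewrite addn0.
by rewrite -addnA; congr (_ + _); apply: IH.
Qed.

Lemma asc_size s : s != [::] -> asc s < size s.
Proof.
case: s => // x s _; elim: s x => [|y s IH] x //=.
by rewrite -addnS; apply: (leq_add (leq_b1 (x < y)) (IH y)).
Qed.

Lemma is_ascent_seqP x : reflect
  (head 0 x = 0 /\
   forall i, 0 < i < size x -> nth 0 x i <= (asc (take i x)).+1)
  (is_ascent_seq x).
Proof.
apply: (iffP andP) => [[/eqP h0 /forallP h]|[h0 h]]; split=> //.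
- move=> i /andP[i0 ix].
  by have := h (Ordinal ix); rewrite /= i0.
- exact/eqP.
- by apply/forallP => -[i ix]; apply/implyP => /= i0; apply: h; rewrite i0.
Qed.

Lemma is_ascent_seq_rcons s k : s != [::] ->
  is_ascent_seq (rcons s k) = is_ascent_seq s && (k <= (asc s).+1).
Proof.
move=> s0; have ss : 0 < size s by case: s s0.
have hd : head 0 (rcons s k) = head 0 s by case: s s0 {ss}.
apply/is_ascent_seqP/andP => [[h0 h]|[/is_ascent_seqP[h0 h] hk]].
  split.
    apply/is_ascent_seqP; split; first by rewrite -hd.
    move=> i /andP[i0 ix]; have := h i; rewrite size_rcons nth_rcons ix.
    rewrite -cats1 takel_cat; last exact: ltnW.
    by apply; lia.
  have := h (size s); rewrite size_rcons nth_rcons ltnn eqxx.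
  by rewrite -cats1 takel_cat // take_size; apply; rewrite ss ltnSn.
rewrite hd; split=> // i; rewrite size_rcons ltnS => /andP[i0].
rewrite leq_eqVlt => /orP[/eqP->|ix].
  by rewrite nth_rcons ltnn eqxx -cats1 takel_cat // take_size.
rewrite nth_rcons ix -cats1 takel_cat; last exact: ltnW.
by apply: h; rewrite i0.
Qed.

Definition valid P s := is_ascent_seq s && all (avoids s) P.

Lemma valid_rcons P s k : s != [::] -> [::] \notin P ->
  reflect [/\ valid P s, k <= (asc s).+1 & {in P, forall p, keeps_avoiding p s k}]
          (valid P (rcons s k)).
Proof.
move=> s0 P0.
have pn0 p : p \in P -> p != [::] by apply: contraTneq => ->.
rewrite /valid is_ascent_seq_rcons //.
apply: (iffP idP) => [/andP[/andP[-> ->] /allP h]|[/andP[-> /allP h] -> hP]] /=.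
  split=> [|//|p pP]; last by case/avoids_rcons: (h p pP) => //; apply: pn0.
  by apply/allP => p pP; case/avoids_rcons: (h p pP) => //; apply: pn0.
apply/allP => p pP; apply/avoids_rcons; first exact: pn0.
by split; [apply: h|apply: hP].
Qed.

(** * Counting the valid extensions of a prefix over a fixed alphabet *)

Definition nb_ext P B m s :=
  #|[set t : m.-tuple 'I_B | valid P (s ++ map val t)]|.

Lemma nb_ext0 P B s : valid P s -> nb_ext P B 0 s = 1.
Proof.
move=> vs; rewrite /nb_ext (_ : [set _ | _] = [set: 0.-tuple 'I_B]).
  by rewrite cardsT card_tuple expn0.
by apply/setP => t; rewrite !inE tuple0 /= cats0.
Qed.

Lemma nb_extS P B m s :
  nb_ext P B m.+1 s = \sum_(k < B) nb_ext P B m (rcons s k).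
Proof.
rewrite /nb_ext -sum1_card (partition_big (fun t : m.+1.-tuple 'I_B => thead t) predT) //=.
apply: eq_bigr => k _; rewrite -sum1_card.
rewrite (reindex_onto (fun t : m.-tuple 'I_B => [tuple of k :: t])
                      (fun t => [tuple of behead t])) /=.
  apply: eq_bigl => t; rewrite !inE /= cat_rcons theadE eqxx andbT.
  by rewrite (_ : [tuple of _] = t) ?eqxx ?andbT //; apply: val_inj.
by move=> t /andP[_ /eqP <-]; rewrite [RHS]tuple_eta; apply: val_inj.
Qed.

Lemma valid_cat P s w : s != [::] -> [::] \notin P -> valid P (s ++ w) -> valid P s.
Proof.
move=> s0 P0; elim/last_ind: w => [|w k IH]; first by rewrite cats0.
rewrite -rcons_cat => /valid_rcons[||/IH] //.
by case: (s) s0.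
Qed.

(** Letters outside [L] contribute 0 because prefixes of valid sequences are valid, and [size s < B]
    ensures that the alphabet contains all of [L]. *)
Lemma nb_ext_children P B m s L : s != [::] -> [::] \notin P -> size s < B ->
  uniq L -> (forall k, valid P (rcons s k) <-> k \in L) ->
  nb_ext P B m.+1 s = \sum_(k <- L) nb_ext P B m (rcons s k).
Proof.
move=> s0 P0 sB uL hL.
rewrite nb_extS -(big_mkord xpredT (fun k => nb_ext P B m (rcons s k))).
rewrite (bigID (fun k => k \in L)) /= [X in _ + X]big1 ?addn0; last first.
  move=> k kL; apply/eqP; rewrite cards_eq0; apply/eqP/setP => t; rewrite !inE.
  apply: contraNF kL => /valid_cat v; apply/hL/v => //.
  by case: (s).
rewrite -big_filter; apply: perm_big; apply: uniq_perm => //.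
  by rewrite filter_uniq // iota_uniq.
move=> k; rewrite mem_filter mem_index_iota /=; case: (boolP (k \in L)) => //= kL.
(* An admissible letter is at most [(asc s).+1], hence at most [size s], hence below [B]. *)
have /valid_rcons[//|//|_ hk _] := (hL k).2 kL.
by have := asc_size s0; lia.
Qed.

Lemma a_P_nb_ext P n : a_P P n = nb_ext P n n [::].
Proof. by apply: eq_card => t; rewrite !inE. Qed.

(** * Restricted growth functions with maximum [k] *)

Record rgf k s : Prop := Rgf {
  rgf_mem : forall a, (a \in s) = (a <= k);
  rgf01 : forall a b, oc01 s a b = (a < b <= k);
  rgf012 : forall a b c, oc012 s a b c = [&& a < b, b < c & c <= k] }.

Lemma rgf_neq0 k s : rgf k s -> s != [::].
Proof. by move=> r; apply/eqP => s0; have := rgf_mem r 0; rewrite s0. Qed.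

(** A new maximum [k.+1] comes after all of 0, ..., k, which supplies exactly the new occurrences of
    01 and 012; a smaller letter only repeats pairs and triples already present. *)
Lemma rgf_rcons k s x : rgf k s -> x <= k.+1 -> rgf (maxn k x) (rcons s x).
Proof.
move=> r xk; split=> [a|a b|a b c].
- rewrite mem_rcons inE (rgf_mem r); lia.
- rewrite oc01_rcons (rgf01 r) (rgf_mem r); lia.
- rewrite oc012_rcons (rgf012 r) (rgf01 r); lia.
Qed.

Lemma rgf_rcons_le k s x : rgf k s -> x <= k -> rgf k (rcons s x).
Proof.
by move=> r xk; rewrite -{1}(maxn_idPl xk); apply: rgf_rcons => //; apply: leqW.
Qed.

Lemma rgf_rconsS k s : rgf k s -> rgf k.+1 (rcons s k.+1).
Proof. by move=> r; rewrite -{1}(maxn_idPr (leqnSn k)); apply: rgf_rcons. Qed.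

Lemma oc010_lt s a b : oc010 s a b -> a < b.
Proof. by case/andP. Qed.

(** * Generating trees for triples of patterns *)

Lemma valid_rcons3 p q r s k : s != [::] -> [::] \notin [:: p; q; r] ->
  valid [:: p; q; r] s ->
  valid [:: p; q; r] (rcons s k) <->
  [/\ k <= (asc s).+1, keeps_avoiding p s k, keeps_avoiding q s k & keeps_avoiding r s k].
Proof.
move=> s0 P0 vs; split=> [/valid_rcons[]// _ hk h|[hk hp hq hr]].
  by split=> //; apply: h; rewrite !inE eqxx ?orbT.
by apply/valid_rcons => //; split=> // x; rewrite !inE => /or3P[]/eqP->.
Qed.

(* A generating tree: [Inv q s] says that [s] has label [q], [L q] lists the
   letters that may follow, [nx] gives the labels of the children, and [c q m]
   is the number of descendants [m] levels below a node labelled [q]. *)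
Lemma nb_ext_tree P B (Q : Type) (Inv : Q -> seq nat -> Prop)
    (L : Q -> seq nat) (nx : Q -> nat -> Q) (c : Q -> nat -> nat) :
  [::] \notin P ->
  (forall q s, Inv q s -> s != [::]) ->
  (forall q, uniq (L q)) ->
  (forall q s k, valid P s -> Inv q s -> valid P (rcons s k) <-> k \in L q) ->
  (forall q s k, Inv q s -> k \in L q -> Inv (nx q k) (rcons s k)) ->
  (forall q, c q 0 = 1) ->
  (forall q m, c q m.+1 = \sum_(k <- L q) c (nx q k) m) ->
  forall m q s, valid P s -> Inv q s -> size s + m <= B ->
  nb_ext P B m s = c q m.
Proof.
move=> P0 s0 uL hL hnx c0 cS; elim=> [|m IH] q s vs iq sB.
  by rewrite nb_ext0 ?c0.
have sB' : size s < B by lia.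
rewrite (nb_ext_children _ (s0 q s iq) P0 sB' (uL q) (fun k => hL q s k vs iq)).
rewrite cS [LHS]big_seq_cond [RHS]big_seq_cond; apply: eq_bigr => k /andP[kL _].
by apply: IH; [apply/(hL q)|apply: hnx|rewrite size_rcons; lia].
Qed.

(* The sequences [0 ... 0 1]. *)
Record start s : Prop := Start {
  start_rgf : rgf 1 s;
  start_asc : asc s = 1;
  start_last : last 0 s = 1;
  start_oc010 : forall a b, oc010 s a b = false;
  start_oc011 : forall a b, oc011 s a b = false }.

(** * The constant sequences and their children *)

Lemma nseqSr (T : Type) n (x : T) : nseq n.+1 x = rcons (nseq n x) x.
Proof. by elim: n => //= n {1}<-. Qed.

Lemma oc01_nseq j x a b : oc01 (nseq j x) a b = false.
Proof.
elim: j a b => [|j IH] a b; first by rewrite /oc01 andbF.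
by rewrite nseqSr oc01_rcons IH mem_nseq; lia.
Qed.

Lemma oc_nseq j x a b :
  [/\ oc010 (nseq j x) a b = false, oc011 (nseq j x) a b = false
    & forall c, oc012 (nseq j x) a b c = false].
Proof.
elim: j a b => [|j IH] a b.
  by rewrite /oc010 /oc011 /oc012 !andbF; split=> // c; rewrite !andbF.
have [h1 h2 h3] := IH a b; rewrite nseqSr; split=> [||c].
- by rewrite oc010_rcons h1 oc01_nseq andbF.
- by rewrite oc011_rcons h2 oc01_nseq andbF.
- by rewrite oc012_rcons h3 oc01_nseq !andbF.
Qed.

Lemma asc_nseq j x : asc (nseq j x) = 0.
Proof. by case: j => // j; elim: j => //= j ->; rewrite ltnn. Qed.

Lemma start_nseq i : start (rcons (nseq i.+1 0) 1).
Proof.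
split.
- split=> [a|a b|a b c].
  + rewrite mem_rcons inE mem_nseq; lia.
  + rewrite oc01_rcons oc01_nseq mem_nseq; lia.
  + have [_ _ h] := oc_nseq i.+1 0 a b.
    by rewrite oc012_rcons h oc01_nseq !andbF; lia.
- by rewrite asc_rcons // asc_nseq nseqSr last_rcons.
- by rewrite last_rcons.
- by move=> a b; have [h _ _] := oc_nseq i.+1 0 a b; rewrite oc010_rcons h oc01_nseq andbF.
- by move=> a b; have [_ h _] := oc_nseq i.+1 0 a b; rewrite oc011_rcons h oc01_nseq andbF.
Qed.

Definition patterns := [:: [:: 0; 1; 0; 1]; [:: 0; 1; 0; 2]; [:: 0; 1; 1; 2];
  [:: 0; 1; 2; 0]; [:: 0; 1; 2; 1]].

(** Each of the five patterns starts with 010, 011 or 012, none of which occurs in a constant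
    sequence. *)
Lemma keeps_avoiding_nseq p i k : p \in patterns -> keeps_avoiding p (nseq i 0) k.
Proof.
rewrite !inE => /or4P[/eqP->|/eqP->|/eqP->|/orP[]/eqP->].
- by apply/keeps_avoiding_0101 => a; have [-> _ _] := oc_nseq i 0 a k.
- by apply/keeps_avoiding_0102 => a b; have [-> _ _] := oc_nseq i 0 a b.
- by apply/keeps_avoiding_0112 => a b; have [_ -> _] := oc_nseq i 0 a b.
- by apply/keeps_avoiding_0120 => b c; have [_ _ ->] := oc_nseq i 0 k b.
- by apply/keeps_avoiding_0121 => a c; have [_ _ ->] := oc_nseq i 0 a k.
Qed.

Lemma patterns_nil (P : seq (seq nat)) : {subset P <= patterns} -> [::] \notin P.
Proof. by move=> sP; apply/negP => /sP. Qed.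

Lemma valid_nseq_rcons (P : seq (seq nat)) i k : {subset P <= patterns} -> valid P (nseq i.+1 0) ->
  valid P (rcons (nseq i.+1 0) k) <-> k \in [:: 0; 1].
Proof.
move=> sP v; rewrite !inE; split=> [/valid_rcons[]//|kE].
- exact: patterns_nil.
- by rewrite asc_nseq => _; case: k => [|[]].
apply/valid_rcons => //; first exact: patterns_nil.
split=> //; first by rewrite asc_nseq; case/orP: kE => /eqP->.
by move=> p /sP; apply: keeps_avoiding_nseq.
Qed.

Lemma valid_nseq (P : seq (seq nat)) i : {subset P <= patterns} -> valid P (nseq i.+1 0).
Proof.
move=> sP; elim: i => [|i IH]; last by rewrite nseqSr; apply/valid_nseq_rcons.
apply/andP; split; first by apply/is_ascent_seqP; split=> // -[].
apply/allP => p /sP pP; apply/negP => /containsP[u us e].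
have := size_subseq us; rewrite -size_red e.
by move: pP; rewrite !inE => /or4P[/eqP->|/eqP->|/eqP->|/orP[]/eqP->].
Qed.

(** The two children of a constant sequence give f(m+1) = f(m) + (2^(m+1) - 1), with f(0) = 1. *)
Lemma nb_ext_nseq (P : seq (seq nat)) B : {subset P <= patterns} ->
  (forall m s, valid P s -> start s -> size s + m <= B ->
     nb_ext P B m s = 2 ^ m.+1 - 1) ->
  forall m i, i.+1 + m <= B -> nb_ext P B m (nseq i.+1 0) = 2 ^ m.+1 - m.+1.
Proof.
move=> sP H; elim=> [|m IH] i iB; first by rewrite nb_ext0 //; apply: valid_nseq.
have v := valid_nseq i sP.
rewrite (@nb_ext_children _ _ _ _ [:: 0; 1]) ?patterns_nil ?size_nseq //.
- rewrite big_cons big_seq1 -nseqSr IH ?H //; last 1 first.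
  + by rewrite addSnnS.
  (* The bound m+1 < 2^(m+1) keeps the truncated subtractions exact. *)
  + have := ltn_expl m.+1 (ltnSn 1); rewrite !expnS; lia.
  + exact/valid_nseq_rcons.
  + exact: start_nseq.
  + by rewrite size_rcons size_nseq addSnnS.
- lia.
- by move=> k; apply: valid_nseq_rcons.
Qed.

Lemma a_P_start (P : seq (seq nat)) n : {subset P <= patterns} ->
  (forall B m s, valid P s -> start s -> size s + m <= B ->
     nb_ext P B m s = 2 ^ m.+1 - 1) ->
  0 < n -> a_P P n = 2 ^ n - n.
Proof.
case: n => // n sP H _.
(* The first letter is split off by hand, since the description of children concerns nonempty
   prefixes. Only the letter 0 contributes. *)
rewrite a_P_nb_ext nb_extS big_ord_recl (nb_ext_nseq sP (H n.+1) (i := 0)) //.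
rewrite big1 ?addn0 // => k _.
apply/eqP; rewrite cards_eq0; apply/eqP/setP => t; rewrite !inE.
by apply/negP => /andP[/is_ascent_seqP[]].
Qed.

(** The recurrence at a [Rise] node below: one child whose descent never branches and two children
    of the same kind. *)
Lemma exp2_pred m : 2 ^ m.+2 - 1 = 1 + ((2 ^ m.+1 - 1) + (2 ^ m.+1 - 1)).
Proof. by have := expn_gt0 2 m.+1; rewrite (expnS 2 m.+1) /=; lia. Qed.

(** * The pair 0101, 0102 with 0120 or 0121 *)

(** In the tree, [Rise k] marks the weakly increasing sequences with maximum k+1, and [Flat k] those
    that have returned to [r k], after which only [r k] can follow. *)
Inductive label_return := Rise of nat | Flat of nat.

Definition inv_return (r : nat -> nat) q s :=
  match q with
  | Rise k => [/\ rgf k.+1 s, asc s = k.+1, last 0 s = k.+1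
              & forall a b, oc010 s a b = false]
  | Flat k => [/\ rgf k.+1 s, k < asc s, oc010 s (r k) k.+1
              & forall a b, oc010 s a b -> a = r k]
  end.

Definition letters_return (r : nat -> nat) q :=
  match q with
  | Rise k => [:: r k; k.+1; k.+2]
  | Flat k => [:: r k]
  end.

Definition next_return q x :=
  match q with
  | Rise k => if k < x then Rise x.-1 else Flat k
  | Flat k => Flat k
  end.

Definition count_return q m := if q is Rise _ then 2 ^ m.+1 - 1 else 1.

(* [r k] is the only letter smaller than the maximum [k.+1] that the third
   pattern [p] permits once [k.+1] has occurred. *)
Lemma nb_ext_return p (r : nat -> nat) B m s :
  p != [::] -> (forall k, r k <= k) ->
  (forall k s x, rgf k.+1 s -> x <= k.+2 ->
     keeps_avoiding p s x <-> x \in [:: r k; k.+1; k.+2]) ->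
  let P := [:: [:: 0; 1; 0; 1]; [:: 0; 1; 0; 2]; p] in
  valid P s -> start s -> size s + m <= B -> nb_ext P B m s = 2 ^ m.+1 - 1.
Proof.
move=> p0 rk hp P vs st sB.
have P0 : [::] \notin P by rewrite !inE /= eq_sym.
apply: (@nb_ext_tree P B _ (inv_return r) (letters_return r) next_return
  count_return _ _ _ _ _ _ _ m (Rise 0)) => //.
- by move=> [k|k] {vs st sB}s [/rgf_neq0].
- by move=> [k|k] //=; rewrite !inE; have := rk k; lia.
- move=> [k|k] {vs st sB}s x vs inv.
    have [rg as_ la no] := inv.
    have /(valid_rcons3 x) V := vs; rewrite {}V ?(rgf_neq0 rg) // as_.
    split=> [[xk _ _ /(hp k)]|xL]; first exact.
    have xk : x <= k.+2 by move: xL; rewrite !inE; have := rk k; lia.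
    split=> //.
    + by apply/keeps_avoiding_0101 => a; rewrite no.
    + by apply/keeps_avoiding_0102 => a b; rewrite no.
    + exact/(hp k).
  have [rg as_ oc no] := inv; have rkk := rk k.
  have /(valid_rcons3 x) V := vs; rewrite {}V ?(rgf_neq0 rg) //.
  split=> [[_ /keeps_avoiding_0101 h1 /keeps_avoiding_0102 h2 h3]|].
    (* By 0102 the occurrence r k, k+1, r k bounds the letter by k+1; the third pattern then leaves
       [r k] and k+1, and 0101 rules out k+1. *)
    have xk := h2 _ _ oc; move/(hp k s x rg (leqW xk)): h3; rewrite !inE.
    have := h1 (r k); case: (x =P k.+1) => [->|_ _]; first by rewrite oc.
    lia.
  rewrite inE => /eqP->; split.
  + lia.
  + by apply/keeps_avoiding_0101 => a; apply/negP => h; have := no _ _ h; have := oc010_lt h; lia.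
  + by apply/keeps_avoiding_0102 => a b h; have := no _ _ h; have := oc010_lt h; lia.
  + by apply/(hp k); rewrite ?inE ?eqxx //; lia.
- move=> [k|k] {vs st sB}s x [rg as_ h1 h2] xL; have rkk := rk k; last first.
    move: xL; rewrite inE => /eqP-> /=; split.
    + by apply: rgf_rcons_le => //; lia.
    + by rewrite asc_rcons ?(rgf_neq0 rg) //; lia.
    + by rewrite oc010_rcons h1.
    + by move=> a b; rewrite oc010_rcons => /orP[/h2|/andP[/eqP]].
  move: xL; rewrite !inE /= => /or3P[]/eqP->.
  + rewrite ltnNge rkk /=; split.
    * by apply: rgf_rcons_le => //; lia.
    * by rewrite asc_rcons ?(rgf_neq0 rg) //; lia.
    * by rewrite oc010_rcons (rgf01 rg); lia.
    * by move=> a b; rewrite oc010_rcons h2 => /andP[/eqP].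
  + rewrite leqnn /=; split.
    * exact: rgf_rcons_le.
    * by rewrite asc_rcons ?(rgf_neq0 rg) //; lia.
    * by rewrite last_rcons.
    * by move=> a b; rewrite oc010_rcons h2 (rgf01 rg); lia.
  + rewrite leqW //=; split.
    * exact: rgf_rconsS.
    * by rewrite asc_rcons ?(rgf_neq0 rg) //; lia.
    * by rewrite last_rcons.
    * by move=> a b; rewrite oc010_rcons h2 (rgf01 rg); lia.
- by case.
- move=> [k|k] {vs st sB}m /=; last by rewrite big_seq1.
  by rewrite !big_cons big_nil addn0 !ltnS ltnNge rk leqnn leqnSn exp2_pred.
- by case: st.
Qed.

(** * The pair 0101, 0102 with 0112 *)

(** [Up k] marks the sequences 0 ... 0 1 2 ... k+1. A next letter other than k+2 starts a weakly
    decreasing tail, and [Down k j] records its last letter [j]. *)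
Inductive label_0112 := Up of nat | Down of nat & nat.

(** At a [Down] node one occurrence, 010 or 0jj, obstructs all letters above [j], and the lower
    bounds on occurrences make the letters up to [j] harmless. *)
Definition inv_0112 q s :=
  match q with
  | Up k => [/\ rgf k.+1 s, asc s = k.+1, last 0 s = k.+1,
              forall a b, oc010 s a b = false & forall a b, oc011 s a b = false]
  | Down k j => [/\ rgf k.+1 s, j <= asc s /\ j <= k.+1,
              if j is 0 then oc010 s 0 1 else oc011 s 0 j,
              forall a b, oc010 s a b -> j <= a
              & forall a b, oc011 s a b -> j <= b]
  end.

Definition letters_0112 q :=
  match q with Up k => iota 0 k.+3 | Down _ j => iota 0 j.+1 end.

Definition next_0112 q x :=
  match q with
  | Up k => if x <= k.+1 then Down k x else Up k.+1
  | Down k j => Down k x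
  end.

(** [Down] counts weakly decreasing words of length [m] over 0, ..., j; [Up k] is the sum of row
    m+k+1 of Pascal's triangle from column k+1 on. *)
Definition count_0112 q m :=
  match q with
  | Up k => \sum_(t < m.+1) 'C(m + k.+1, k.+1 + t)
  | Down _ j => 'C(m + j, j)
  end.

(** The hockey-stick identity; it sorts weakly decreasing words of length m+1 by their first
    letter. *)
Lemma sum_bin_diag m j : \sum_(i <- iota 0 j.+1) 'C(m + i, i) = 'C(m.+1 + j, j).
Proof.
elim: j => [|j IH]; first by rewrite big_seq1 !bin0.
rewrite -addn1 iotaD big_cat big_seq1 /= IH ?add0n.
by rewrite addSnnS [RHS]binS addnC.
Qed.

Lemma nb_ext_0112 B m s :
  let P := [:: [:: 0; 1; 0; 1]; [:: 0; 1; 0; 2]; [:: 0; 1; 1; 2]] in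
  valid P s -> start s -> size s + m <= B -> nb_ext P B m s = 2 ^ m.+1 - 1.
Proof.
move=> P vs st sB.
(* Expand (1+1)^(m+1) by the binomial theorem and drop the first term. *)
have -> : 2 ^ m.+1 - 1 = count_0112 (Up 0) m.
  rewrite -[2]/(1 + 1) expnDn big_ord_recl /= bin0 !exp1n !muln1 addKn.
  by apply: eq_bigr => t _; rewrite !exp1n !muln1 addn1.
apply: (@nb_ext_tree P B _ inv_0112 letters_0112 next_0112 count_0112) => //.
- by move=> [k|k j] {vs st sB}s [/rgf_neq0].
- by move=> [k|k j]; apply: iota_uniq.
- move=> [k|k j] {vs st sB}s x vs inv.
    have [rg as_ la no0 no1] := inv.
    have /(valid_rcons3 x) V := vs; rewrite {}V ?(rgf_neq0 rg) // as_ mem_iota.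
    split=> [[]|xk]; first by rewrite ltnS.
    split; first by rewrite ltnS in xk.
    + by apply/keeps_avoiding_0101 => a; rewrite no0.
    + by apply/keeps_avoiding_0102 => a b; rewrite no0.
    + by apply/keeps_avoiding_0112 => a b; rewrite no1.
  have [rg [jas jk] oc no0 no1] := inv.
  have /(valid_rcons3 x) V := vs; rewrite {}V ?(rgf_neq0 rg) // mem_iota.
  split=> [[_ /keeps_avoiding_0101 h1 /keeps_avoiding_0102 h2 /keeps_avoiding_0112 h3]|xj].
    (* For positive [j], 0112 applied to 0jj gives the bound. For [j] = 0, 0102 applied to 010
       leaves 0 and 1, and 0101 removes 1. *)
    case: j {jas jk inv no0 no1} oc => [|j] oc; last exact: h3 oc.
    have := h2 _ _ oc; have := h1 0; case: x {h1 h2 h3} => [|[|x]] //.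
    by rewrite oc.
  have {}xj : x <= j by rewrite ltnS in xj.
  split; first lia.
  + apply/keeps_avoiding_0101 => a; apply/negP => h.
    by have := no0 _ _ h; have := oc010_lt h; lia.
  + by apply/keeps_avoiding_0102 => a b h; have := no0 _ _ h; have := oc010_lt h; lia.
  + by apply/keeps_avoiding_0112 => a b h; have := no1 _ _ h; lia.
(* Entering the decreasing tail and continuing it are the same step. *)
- have down k s' x : rgf k.+1 s' -> x <= k.+1 -> x <= asc s' ->
      (forall a b, oc010 s' a b -> x <= a) ->
      (forall a b, oc011 s' a b -> x <= b) -> inv_0112 (Down k x) (rcons s' x).
    move=> rg xk xa h0 h1; split.
    * exact: rgf_rcons_le.
    * by rewrite asc_rcons ?(rgf_neq0 rg) //; lia.
    * case: x xk {xa h0 h1} => [|x] xk.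
        by rewrite oc010_rcons (rgf01 rg); lia.
      by rewrite oc011_rcons (rgf01 rg); lia.
    * by move=> a b; rewrite oc010_rcons => /orP[/h0|/andP[/eqP->]].
    * by move=> a b; rewrite oc011_rcons => /orP[/h1|/andP[/eqP->]].
  move=> [k|k j] {vs st sB}s x.
    move=> [rg as_ la no0 no1]; rewrite mem_iota [next_0112 _ _]/=.
    case: (leqP x k.+1) => [xk _|kx xk].
      by apply: down => //; rewrite ?as_ // => a b; rewrite ?no0 ?no1.
    have -> : x = k.+2 by lia.
    split.
    * exact: rgf_rconsS.
    * by rewrite asc_rcons ?(rgf_neq0 rg) //; lia.
    * by rewrite last_rcons.
    * by move=> a b; rewrite oc010_rcons no0 (rgf01 rg); lia.
    * by move=> a b; rewrite oc011_rcons no1 (rgf01 rg); lia.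
  move=> [rg [jas jk] oc no0 no1]; rewrite mem_iota [next_0112 _ _]/= => xj.
  apply: down => //; try lia.
  + by move=> a b /no0; lia.
  + by move=> a b /no1; lia.
- by move=> [k|k j]; rewrite /= ?big_ord1 add0n ?addn0 binn.
- move=> [k|k j] {vs st sB}m; rewrite /letters_0112 /next_0112 /count_0112; last first.
    by rewrite sum_bin_diag.
  (* The [Down] children sum to the first term of the row tail, and the child [Up k.+1] gives the
     remaining terms. *)
  rewrite -[k.+3]addn1 iotaD big_cat big_seq1 add0n ltnn.
  rewrite big_ord_recl addn0 -sum_bin_diag; congr (_ + _).
    rewrite big_seq_cond [RHS]big_seq_cond; apply: eq_bigr => x /andP[].
    by rewrite mem_iota /= ltnS => ->.
  by apply: eq_bigr => t _; rewrite lift0 !addSn !addnS.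
- by case: st.
Qed.

(** * The triple 0101, 0112, 0121 *)

(* The last letter is the maximum [k.+1], occurring once ([Top]) or repeatedly
   ([Plateau]); or it is a return to 0 from such a sequence ([Zero], [Dead]). *)
Inductive label_0112_0121 :=
  Top of nat | Zero of nat | Plateau of nat | Dead of nat.

(** At [Top] and [Plateau] nodes earlier returns to 0 enclose only letters below the maximum, hence
    [b <= k]. The number of ascents is fixed exactly where a new maximum may follow. *)
Definition inv_0112_0121 q s :=
  match q with
  | Top k => [/\ rgf k.+1 s, asc s = k.+1, last 0 s = k.+1,
      forall a b, oc010 s a b -> a = 0 /\ b <= k
      & forall a b, oc011 s a b = false]
  | Zero k => [/\ rgf k.+1 s, asc s = k.+1, last 0 s = 0,
      forall a b, oc010 s a b = (a == 0) && (0 < b <= k.+1)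
      & forall a b, oc011 s a b = false]
  | Plateau k => [/\ rgf k.+1 s, k < asc s, oc011 s 0 k.+1,
      forall a b, oc010 s a b -> a = 0 /\ b <= k
      & forall a b, oc011 s a b -> b = k.+1]
  | Dead k => [/\ rgf k.+1 s, oc011 s 0 k.+1
      & forall b, 0 < b <= k.+1 -> oc010 s 0 b]
  end.

(** Letters strictly between 0 and the maximum are excluded by 0121. After a return to 0, 0101
    excludes the maximum; after a repeated maximum, 0112 excludes anything larger. *)
Definition letters_0112_0121 q :=
  match q with
  | Top k => [:: 0; k.+1; k.+2]
  | Zero k => [:: 0; k.+2]
  | Plateau k => [:: 0; k.+1]
  | Dead _ => [:: 0]
  end.

Definition next_0112_0121 q x :=
  match q with
  | Top k => if x is 0 then Zero k else if x == k.+1 then Plateau k else Top k.+1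
  | Zero k => if x is 0 then Zero k else Top k.+1
  | Plateau k => if x is 0 then Dead k else Plateau k
  | Dead k => Dead k
  end.

Definition count_0112_0121 q m :=
  match q with
  | Top _ => 2 ^ m.+1 - 1
  | Zero _ => 2 ^ m.+1 - m.+1
  | Plateau _ => m.+1
  | Dead _ => 1
  end.

Lemma nb_ext_0112_0121 B m s :
  let P := [:: [:: 0; 1; 0; 1]; [:: 0; 1; 1; 2]; [:: 0; 1; 2; 1]] in
  valid P s -> start s -> size s + m <= B -> nb_ext P B m s = 2 ^ m.+1 - 1.
Proof.
move=> P vs st sB.
apply: (@nb_ext_tree P B _ inv_0112_0121 letters_0112_0121 next_0112_0121
  count_0112_0121 _ _ _ _ _ _ _ m (Top 0)) => //.
- by move=> [k|k|k|k] {vs st sB}s [/rgf_neq0].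
- by move=> [k|k|k|k] //=; rewrite !inE; lia.
- move=> [k|k|k|k] {vs st sB}s x vs; rewrite !inE.
  + move=> [rg as_ la no0 no1].
    have /(valid_rcons3 x) V := vs; rewrite {}V ?(rgf_neq0 rg) // as_.
    split=> [[xk _ _ /keeps_avoiding_0121/(_ 0 k.+1)]|xL].
      by rewrite (rgf012 rg); lia.
    split; first lia.
    * by apply/keeps_avoiding_0101 => a; apply/negP => h; have := no0 _ _ h; have := oc010_lt h; lia.
    * by apply/keeps_avoiding_0112 => a b; rewrite no1.
    * by apply/keeps_avoiding_0121 => a c; rewrite (rgf012 rg); lia.
  + move=> [rg as_ la no0 no1].
    have /(valid_rcons3 x) V := vs; rewrite {}V ?(rgf_neq0 rg) // as_.
    split=> [[xk /keeps_avoiding_0101/(_ 0) + _ _]|xL].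
      by rewrite no0; lia.
    split; first lia.
    * by apply/keeps_avoiding_0101 => a; rewrite no0; lia.
    * by apply/keeps_avoiding_0112 => a b; rewrite no1.
    * by apply/keeps_avoiding_0121 => a c; rewrite (rgf012 rg); lia.
  + move=> [rg as_ oc no0 no1].
    have /(valid_rcons3 x) V := vs; rewrite {}V ?(rgf_neq0 rg) //.
    split=> [[_ _ /keeps_avoiding_0112/(_ _ _ oc) xk /keeps_avoiding_0121/(_ 0 k.+1)]|xL].
      by rewrite (rgf012 rg); lia.
    split; first lia.
    * by apply/keeps_avoiding_0101 => a; apply/negP => h; have := no0 _ _ h; have := oc010_lt h; lia.
    * by apply/keeps_avoiding_0112 => a b /no1; lia.
    * by apply/keeps_avoiding_0121 => a c; rewrite (rgf012 rg); lia.
  + move=> [rg oc0 oc1].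
    have /(valid_rcons3 x) V := vs; rewrite {}V ?(rgf_neq0 rg) //.
    split=> [[_ /keeps_avoiding_0101/(_ 0) h /keeps_avoiding_0112/(_ _ _ oc0) xk _]|/eqP->].
      by move: h; apply: contraNT => x0; apply: oc1; lia.
    split=> //.
    * by apply/keeps_avoiding_0101 => a; apply/negP => /oc010_lt.
    * by apply/keeps_avoiding_0112 => a b.
    * by apply/keeps_avoiding_0121 => a c; rewrite (rgf012 rg).
- move=> [k|k|k|k] {vs st sB}s x.
  + move=> [rg as_ la no0 no1]; rewrite !inE => /or3P[]/eqP->.
    * rewrite [next_0112_0121 _ _]/=; split.
      - exact: rgf_rcons_le.
      - by rewrite asc_rcons ?(rgf_neq0 rg) //; lia.
      - by rewrite last_rcons.
      - move=> a b; rewrite oc010_rcons (rgf01 rg).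
        by case: (boolP (oc010 s a b)) => [h|_]; [have := no0 _ _ h; have := oc010_lt h|]; lia.
      - by move=> a b; rewrite oc011_rcons no1 (rgf01 rg); lia.
    * rewrite [next_0112_0121 _ _]/= eqxx; split.
      - exact: rgf_rcons_le.
      - by rewrite asc_rcons ?(rgf_neq0 rg) //; lia.
      - by rewrite oc011_rcons (rgf01 rg); lia.
      - by move=> a b; rewrite oc010_rcons (rgf01 rg) => /orP[/no0//|]; lia.
      - by move=> a b; rewrite oc011_rcons no1 => /andP[/eqP].
    * rewrite [next_0112_0121 _ _]/= eqSS -[_ == _]/(k.+1 == k) gtn_eqF //; split.
      - exact: rgf_rconsS.
      - by rewrite asc_rcons ?(rgf_neq0 rg) //; lia.
      - by rewrite last_rcons.
      - by move=> a b; rewrite oc010_rcons (rgf01 rg) => /orP[/no0[]|]; lia.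
      - by move=> a b; rewrite oc011_rcons no1 (rgf01 rg); lia.
  + move=> [rg as_ la no0 no1]; rewrite !inE => /orP[]/eqP->;
      rewrite [next_0112_0121 _ _]/=; split.
    * exact: rgf_rcons_le.
    * by rewrite asc_rcons ?(rgf_neq0 rg) //; lia.
    * by rewrite last_rcons.
    * by move=> a b; rewrite oc010_rcons no0 (rgf01 rg); lia.
    * by move=> a b; rewrite oc011_rcons no1 (rgf01 rg); lia.
    * exact: rgf_rconsS.
    * by rewrite asc_rcons ?(rgf_neq0 rg) //; lia.
    * by rewrite last_rcons.
    * by move=> a b; rewrite oc010_rcons no0 (rgf01 rg); lia.
    * by move=> a b; rewrite oc011_rcons no1 (rgf01 rg); lia.
  + move=> [rg as_ oc no0 no1]; rewrite !inE => /orP[]/eqP->;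
      rewrite [next_0112_0121 _ _]/=; split.
    * exact: rgf_rcons_le.
    * by rewrite oc011_rcons oc.
    * by move=> b hb; rewrite oc010_rcons (rgf01 rg); lia.
    * exact: rgf_rcons_le.
    * by rewrite asc_rcons ?(rgf_neq0 rg) //; lia.
    * by rewrite oc011_rcons oc.
    * by move=> a b; rewrite oc010_rcons (rgf01 rg) => /orP[/no0//|]; lia.
    * by move=> a b; rewrite oc011_rcons => /orP[/no1//|/andP[/eqP]].
  + move=> [rg oc0 oc1]; rewrite inE => /eqP->; split.
    * exact: rgf_rcons_le.
    * by rewrite oc011_rcons oc0.
    * by move=> b /oc1; rewrite oc010_rcons => ->.
- by case.
- move=> [k|k|k|k] {vs st sB}m /=; rewrite !big_cons ?big_nil ?eqxx ?addn0 //.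
  + rewrite -[k.+2 == k.+1]/(k.+1 == k) gtn_eqF //.
    (* The terms m+1 of [Zero] and [Plateau] cancel; the bound m+1 < 2^(m+1) makes the truncated
       subtraction exact. *)
    by have := ltn_expl m.+1 (ltnSn 1); rewrite (expnS 2 m.+1) /count_0112_0121; lia.
  + by have := ltn_expl m.+1 (ltnSn 1); rewrite (expnS 2 m.+1) /count_0112_0121; lia.
- by case: st => rg as_ la no0 no1; split=> // a b; rewrite no0.
Qed.

(** * The pair 0120, 0121 with 0101 or 0102 *)

(* [Ones]: the sequences [0 ... 0 1 ... 1]; [Back]: binary with a return to 0;
   [Weak k]: the maximum is [k.+2]. *)
Inductive label_0120_0121 := Ones | Back | Weak of nat.

(* [j] is the other letter that may follow a binary sequence with a return to 0:
   2 for the pattern 0101, 1 for 0102. *)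
Definition letters_0120_0121 j q :=
  match q with
  | Ones => [:: 0; 1; 2]
  | Back => [:: 0; j]
  | Weak k => [:: k.+2; k.+3]
  end.

Definition next_0120_0121 q x :=
  match q with
  | Weak k => Weak (x - 2)
  | Back => if x is x'.+2 then Weak x' else Back
  | Ones => if x is x'.+2 then Weak x' else if x is 0 then Back else Ones
  end.

Definition count_0120_0121 q m := if q is Ones then 2 ^ m.+1 - 1 else 2 ^ m.

(** [Back] and [Weak] nodes always have two children, each of one of these two kinds. For [j] = 2
    the second child of [Back] is [Weak 0], for [j] = 1 it is [Back]; both count 2^m, so one
    recurrence serves both triples. *)
Lemma count_0120_0121S j : 0 < j <= 2 -> forall q m,
  count_0120_0121 q m.+1 =
  \sum_(x <- letters_0120_0121 j q) count_0120_0121 (next_0120_0121 q x) m.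
Proof.
move=> j12 [||k] m; rewrite !big_cons big_nil addn0 /=.
- by have := expn_gt0 2 m; rewrite !expnS /=; lia.
- by case: j j12 => [|[|[|j]]] //= _; rewrite expnS; lia.
- by rewrite expnS; lia.
Qed.

(** Once 2 has appeared, a 010 can only come from the binary part, so its larger letter is 1, and no
    letter 1 follows. *)
Definition inv_0101_0120_0121 q s :=
  match q with
  | Ones => [/\ rgf 1 s, asc s = 1, last 0 s = 1
            & forall a b, oc010 s a b = false]
  | Back => [/\ rgf 1 s, asc s = 1, last 0 s = 0
            & forall a b, oc010 s a b = (a == 0) && (b == 1)]
  | Weak k => [/\ rgf k.+2 s, asc s = k.+2, last 0 s = k.+2
            & forall a b, oc010 s a b -> b = 1]
  end.

(** After a return to 0, 0102 keeps the sequence binary with 0 and 1 in any order, so the ascents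
    are only bounded below, and [Weak] nodes contain no 010. *)
Definition inv_0102_0120_0121 q s :=
  match q with
  | Ones => [/\ rgf 1 s, asc s = 1, last 0 s = 1
            & forall a b, oc010 s a b = false]
  | Back => [/\ rgf 1 s, 0 < asc s & oc010 s 0 1]
  | Weak k => [/\ rgf k.+2 s, asc s = k.+2, last 0 s = k.+2
            & forall a b, oc010 s a b = false]
  end.

Lemma nb_ext_0101_0120_0121 B m s :
  let P := [:: [:: 0; 1; 0; 1]; [:: 0; 1; 2; 0]; [:: 0; 1; 2; 1]] in
  valid P s -> start s -> size s + m <= B -> nb_ext P B m s = 2 ^ m.+1 - 1.
Proof.
move=> P vs st sB.
apply: (@nb_ext_tree P B _ inv_0101_0120_0121 (letters_0120_0121 2)
  next_0120_0121 count_0120_0121 _ _ _ _ _ _ _ m Ones) => //.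
- by move=> [||k] {vs st sB}s [/rgf_neq0].
- by move=> [||k] //=; rewrite !inE; lia.
- move=> [||k] {vs st sB}s x vs; rewrite !inE => -[rg as_ la no];
    have /(valid_rcons3 x) V := vs; rewrite {}V ?(rgf_neq0 rg) // as_.
  + split=> [[]|xL]; first lia.
    split; first lia.
    * by apply/keeps_avoiding_0101 => a; rewrite no.
    * by apply/keeps_avoiding_0120 => b c; rewrite (rgf012 rg); lia.
    * by apply/keeps_avoiding_0121 => b c; rewrite (rgf012 rg); lia.
  + split=> [[xk /keeps_avoiding_0101/(_ 0) + _ _]|xL]; first by rewrite no; lia.
    split; first lia.
    * by apply/keeps_avoiding_0101 => a; rewrite no; lia.
    * by apply/keeps_avoiding_0120 => b c; rewrite (rgf012 rg); lia.
    * by apply/keeps_avoiding_0121 => b c; rewrite (rgf012 rg); lia.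
  (* Below the maximum k+2, 0120 excludes x <= k through x, k+1, k+2, and 0121 excludes k+1 through
     0, k+1, k+2. *)
  + split=> [[xk _ /keeps_avoiding_0120/(_ k.+1 k.+2) h1 /keeps_avoiding_0121/(_ 0 k.+2) h2]|xL].
      by move: h1 h2; rewrite !(rgf012 rg); lia.
    split; first lia.
    * by apply/keeps_avoiding_0101 => a; apply/negP => /no; lia.
    * by apply/keeps_avoiding_0120 => b c; rewrite (rgf012 rg); lia.
    * by apply/keeps_avoiding_0121 => b c; rewrite (rgf012 rg); lia.
- move=> [||k] {vs st sB}s x [rg as_ la no]; rewrite !inE.
  + move=> /or3P[]/eqP->; rewrite [next_0120_0121 _ _]/=; split;
      rewrite ?last_rcons ?asc_rcons ?(rgf_neq0 rg) ?as_ ?la //;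
      try (by [apply: rgf_rcons_le | apply: rgf_rconsS]);
      by move=> a b; rewrite oc010_rcons no (rgf01 rg); lia.
  + move=> /orP[]/eqP->; rewrite [next_0120_0121 _ _]/=; split;
      rewrite ?last_rcons ?asc_rcons ?(rgf_neq0 rg) ?as_ ?la //;
      try (by [apply: rgf_rcons_le | apply: rgf_rconsS]);
      by move=> a b; rewrite oc010_rcons no (rgf01 rg); lia.
  + move=> /orP[]/eqP->; rewrite [next_0120_0121 _ _]/= !subSS subn0; split;
      rewrite ?last_rcons ?asc_rcons ?(rgf_neq0 rg) ?as_ ?la ?ltnn ?leqnn ?addn0 ?addn1 //;
      try (by [apply: rgf_rcons_le | apply: rgf_rconsS]);
      by move=> a b; rewrite oc010_rcons (rgf01 rg) => /orP[/no//|]; lia.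
- by case.
- exact: count_0120_0121S.
- by case: st.
Qed.

Lemma nb_ext_0102_0120_0121 B m s :
  let P := [:: [:: 0; 1; 0; 2]; [:: 0; 1; 2; 0]; [:: 0; 1; 2; 1]] in
  valid P s -> start s -> size s + m <= B -> nb_ext P B m s = 2 ^ m.+1 - 1.
Proof.
move=> P vs st sB.
apply: (@nb_ext_tree P B _ inv_0102_0120_0121 (letters_0120_0121 1)
  next_0120_0121 count_0120_0121 _ _ _ _ _ _ _ m Ones) => //.
- by move=> [||k] {vs st sB}s [/rgf_neq0].
- by move=> [||k] //=; rewrite !inE; lia.
- move=> [||k] {vs st sB}s x vs; rewrite !inE => -[rg as_];
    have /(valid_rcons3 x) V := vs; rewrite {}V ?(rgf_neq0 rg) //.
  + move=> la no; rewrite as_; split=> [[]|xL]; first lia.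
    split; first lia.
    * by apply/keeps_avoiding_0102 => a b; rewrite no.
    * by apply/keeps_avoiding_0120 => b c; rewrite (rgf012 rg); lia.
    * by apply/keeps_avoiding_0121 => b c; rewrite (rgf012 rg); lia.
  + move=> oc; split=> [[_ /keeps_avoiding_0102/(_ _ _ oc) + _ _]|xL]; first lia.
    split; first lia.
    * by apply/keeps_avoiding_0102 => a b /oc010_lt; lia.
    * by apply/keeps_avoiding_0120 => b c; rewrite (rgf012 rg); lia.
    * by apply/keeps_avoiding_0121 => b c; rewrite (rgf012 rg); lia.
  + move=> la no; rewrite as_.
    split=> [[xk _ /keeps_avoiding_0120/(_ k.+1 k.+2) h1 /keeps_avoiding_0121/(_ 0 k.+2) h2]|xL].
      by move: h1 h2; rewrite !(rgf012 rg); lia.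
    split; first lia.
    * by apply/keeps_avoiding_0102 => a b; rewrite no.
    * by apply/keeps_avoiding_0120 => b c; rewrite (rgf012 rg); lia.
    * by apply/keeps_avoiding_0121 => b c; rewrite (rgf012 rg); lia.
- move=> [||k] {vs st sB}s x [rg as_]; rewrite !inE.
  + move=> la no /or3P[]/eqP->; rewrite [next_0120_0121 _ _]/=; split;
      rewrite ?last_rcons ?asc_rcons ?(rgf_neq0 rg) ?as_ ?la //;
      try (by [apply: rgf_rcons_le | apply: rgf_rconsS]);
      try (by move=> a b; rewrite oc010_rcons no (rgf01 rg); lia);
      by rewrite oc010_rcons (rgf01 rg); lia.
  + move=> oc /orP[]/eqP->; rewrite [next_0120_0121 _ _]/=; split;
      rewrite ?asc_rcons ?(rgf_neq0 rg) ?oc010_rcons ?oc //;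
      try (by apply: rgf_rcons_le); lia.
  + move=> la no /orP[]/eqP->; rewrite [next_0120_0121 _ _]/= !subSS subn0; split;
      rewrite ?last_rcons ?asc_rcons ?(rgf_neq0 rg) ?as_ ?la ?ltnn ?leqnn ?addn0 ?addn1 //;
      try (by [apply: rgf_rcons_le | apply: rgf_rconsS]);
      by move=> a b; rewrite oc010_rcons no (rgf01 rg); lia.
- by case.
- exact: count_0120_0121S.
- by case: st.
Qed.

(** * The six triples together *)

Theorem theorem4p3 (n : nat) : 1 <= n ->
  a_P [:: [:: 0; 1; 0; 1]; [:: 0; 1; 0; 2]; [:: 0; 1; 1; 2]] n = 2 ^ n - n /\
  a_P [:: [:: 0; 1; 0; 1]; [:: 0; 1; 0; 2]; [:: 0; 1; 2; 0]] n = 2 ^ n - n /\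
  a_P [:: [:: 0; 1; 0; 1]; [:: 0; 1; 0; 2]; [:: 0; 1; 2; 1]] n = 2 ^ n - n /\
  a_P [:: [:: 0; 1; 0; 1]; [:: 0; 1; 1; 2]; [:: 0; 1; 2; 1]] n = 2 ^ n - n /\
  a_P [:: [:: 0; 1; 0; 1]; [:: 0; 1; 2; 0]; [:: 0; 1; 2; 1]] n = 2 ^ n - n /\
  a_P [:: [:: 0; 1; 0; 2]; [:: 0; 1; 2; 0]; [:: 0; 1; 2; 1]] n = 2 ^ n - n.
Proof.
move=> n0; split; [|split; [|split; [|split; [|split]]]];
  apply: a_P_start => //; try exact/allP; move=> B m s.
- exact: nb_ext_0112.
(* A letter x < k would complete x, k, k+1 to 0120, so the only possible return is to [k]. *)
- apply: (nb_ext_return (r := id)) => // k {}s x rg xk.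
  split=> [/keeps_avoiding_0120/(_ k k.+1)|xL]; first by rewrite (rgf012 rg) !inE; lia.
  by apply/keeps_avoiding_0120 => b c; rewrite !inE in xL; rewrite (rgf012 rg); lia.
(* A letter x with 0 < x <= k would complete 0, x, k+1 to 0121, so the only possible return is to
   0. *)
- apply: (nb_ext_return (r := fun=> 0)) => // k {}s x rg xk.
  split=> [/keeps_avoiding_0121/(_ 0 k.+1)|xL]; first by rewrite (rgf012 rg) !inE; lia.
  by apply/keeps_avoiding_0121 => b c; rewrite !inE in xL; rewrite (rgf012 rg); lia.
- exact: nb_ext_0112_0121.
- exact: nb_ext_0101_0120_0121.
- exact: nb_ext_0102_0120_0121.
Qed.
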